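(* If $\mathcal M=\langle M,\in^{\mathcal M}\rangle$ is a countable recursively saturated model of $\mathrm{MOST}+\Delta_0^{\mathcal P}\text{-collection}$, then there exists an embedding $h:\mathcal M\to\mathcal M$ such that $\mathrm{rng}(h)\subseteq M$ is an $H$-cut of $\mathcal M$.
   Context: $\mathcal{L}$ is the language with one binary relation $\in$; for $a\in M$, $a^*=\{x\in M:\mathcal M\models x\in a\}$. $\mathrm{Mac}$: extensionality, pairing, emptyset, union, infinity, powerset, transitive containment, $\Delta_0$-separation, set foundation, and ''every set can be well-ordered''. $\mathrm{MOST}=\mathrm{Mac}+\Sigma_1$-separation$+\Delta_0$-collection. $\Delta_0^{\mathcal P}$-collection is the collection scheme restricted to formulae built from atomic formulae using connectives and bounded quantifiers $\exists x\in y,\forall x\in y,\exists x\subseteq y,\forall x\subseteq y$. An embedding $h:\mathcal M\to\mathcal M$ is an injective map with $\mathcal M\models x\in y$ iff $\mathcal M\models h(x)\in h(y)$. For $\mathcal{L}$-structures $\mathcal{A}\subseteq\mathcal{B}$: end-extension means members (in $\mathcal B$) of elements of $A$ lie in $A$; powerset-preserving means additionally every $x\in B$ with $\mathcal B\models x\subseteq y$ for some $y\in A$ lies in $A$; topless means end-extension, $A\ne B$, and every $C\in B$ with $C^*\subseteq\mathrm{Ord}^{\mathcal A}$ lies in $A$. For $\mathcal M\models\mathrm{MOST}$, $I\subseteq M$ is an $H$-cut if $\mathcal M$ is a topless powerset-preserving end-extension of the substructure $\langle I,\in^{\mathcal M}\rangle$ and $\langle I,\in^{\mathcal M}\rangle\models\mathrm{MOST}$.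 Recursively saturated: every recursive type with finitely many parameters that is finitely realised in $\mathcal M$ is realised in $\mathcal M$. *)

(* Defs.v *)
From Stdlib Require List.
From mathcomp Require Import all_boot.

Set Implicit Arguments.
Unset Strict Implicit.
Unset Printing Implicit Defensive.

Record structure := Structure {
  carrier :> Type;
  inn : carrier -> carrier -> Prop
}.

(** * Syntax and satisfaction *)

(* De Bruijn variables: under a quantifier, variable 0 is the bound one. *)
Inductive form : Type :=
| fEq of nat & nat
| fIn of nat & nat
| fNeg of form
| fAnd of form & form
| fOr of form & form
| fImp of form & form
| fAll of form
| fEx of form.

Definition scons (T : Type) (x : T) (v : nat -> T) (i : nat) : T :=
  if i is j.+1 then v j else x.

Fixpoint sat (M : structure) (v : nat -> M) (phi : form) : Prop :=
  match phi with
  | fEq i j => v i = v j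
  | fIn i j => inn (v i) (v j)
  | fNeg f => ~ sat v f
  | fAnd f g => sat v f /\ sat v g
  | fOr f g => sat v f \/ sat v g
  | fImp f g => sat v f -> sat v g
  | fAll f => forall x : M, sat (scons x v) f
  | fEx f => exists x : M, sat (scons x v) f
  end.

(* All free variables of the formula are smaller than n. *)
Fixpoint fv_below (n : nat) (phi : form) : bool :=
  match phi with
  | fEq i j | fIn i j => (i < n) && (j < n)
  | fNeg f => fv_below n f
  | fAnd f g | fOr f g | fImp f g => fv_below n f && fv_below n g
  | fAll f | fEx f => fv_below n.+1 f
  end.

Definition fSub (i j : nat) : form := fAll (fImp (fIn 0 i.+1) (fIn 0 j.+1)).

(* The bounding variable j lives outside the quantifier, hence j.+1 inside; in
   particular it is never the quantified variable itself. *)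
Definition fExIn (j : nat) (f : form) : form := fEx (fAnd (fIn 0 j.+1) f).
Definition fAllIn (j : nat) (f : form) : form := fAll (fImp (fIn 0 j.+1) f).
Definition fExSub (j : nat) (f : form) : form := fEx (fAnd (fSub 0 j.+1) f).
Definition fAllSub (j : nat) (f : form) : form := fAll (fImp (fSub 0 j.+1) f).

Inductive Delta0 : form -> Prop :=
| Delta0_Eq i j : Delta0 (fEq i j)
| Delta0_In i j : Delta0 (fIn i j)
| Delta0_Neg f : Delta0 f -> Delta0 (fNeg f)
| Delta0_And f g : Delta0 f -> Delta0 g -> Delta0 (fAnd f g)
| Delta0_Or f g : Delta0 f -> Delta0 g -> Delta0 (fOr f g)
| Delta0_Imp f g : Delta0 f -> Delta0 g -> Delta0 (fImp f g)
| Delta0_ExIn j f : Delta0 f -> Delta0 (fExIn j f)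
| Delta0_AllIn j f : Delta0 f -> Delta0 (fAllIn j f).

Inductive Sigma1 : form -> Prop :=
| Sigma1_Delta0 f : Delta0 f -> Sigma1 f
| Sigma1_Ex f : Sigma1 f -> Sigma1 (fEx f).

Inductive Delta0P : form -> Prop :=
| Delta0P_Eq i j : Delta0P (fEq i j)
| Delta0P_In i j : Delta0P (fIn i j)
| Delta0P_Neg f : Delta0P f -> Delta0P (fNeg f)
| Delta0P_And f g : Delta0P f -> Delta0P g -> Delta0P (fAnd f g)
| Delta0P_Or f g : Delta0P f -> Delta0P g -> Delta0P (fOr f g)
| Delta0P_Imp f g : Delta0P f -> Delta0P g -> Delta0P (fImp f g)
| Delta0P_ExIn j f : Delta0P f -> Delta0P (fExIn j f)
| Delta0P_AllIn j f : Delta0P f -> Delta0P (fAllIn j f)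
| Delta0P_ExSub j f : Delta0P f -> Delta0P (fExSub j f)
| Delta0P_AllSub j f : Delta0P f -> Delta0P (fAllSub j f).

(** * Theories, as properties of a structure *)

Section Theories.
Variable M : structure.
Implicit Types (x y z w u a b p r : M).

Definition subset x y : Prop := forall z, inn z x -> inn z y.

Definition transitive_set x : Prop := forall y, inn y x -> subset y x.

Definition is_upair p a b : Prop := forall w, inn w p <-> w = a \/ w = b.

(* Kuratowski: p = {{a}, {a, b}}. *)
Definition is_opair p a b : Prop :=
  exists s t : M, [/\ is_upair s a a, is_upair t a b & is_upair p s t].

(* R strictly well-orders the members of x, "well" being tested on the subsets
   of x that are elements of M. *)
Definition well_orders (R : M -> M -> Prop) x : Prop :=
  [/\ forall a, inn a x -> ~ R a a,
      forall a b c : M, inn a x -> inn b x -> inn c x ->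
        R a b -> R b c -> R a c,
      forall a b, inn a x -> inn b x -> [\/ R a b, a = b | R b a]
    & forall u, subset u x -> (exists a, inn a u) ->
        exists2 a, inn a u & forall b, inn b u -> b = a \/ R a b].

Definition is_ordinal x : Prop :=
  transitive_set x /\ well_orders (@inn M) x.

Definition is_wellordering_of r x : Prop :=
  (forall p, inn p r -> exists a b, [/\ inn a x, inn b x & is_opair p a b]) /\
  well_orders (fun a b => exists2 p, is_opair p a b & inn p r) x.

Definition Extensionality : Prop :=
  forall x y, (forall z, inn z x <-> inn z y) -> x = y.

Definition Pairing : Prop := forall x y, exists z, is_upair z x y.

Definition Emptyset : Prop := exists x, forall y, ~ inn y x.

Definition Union : Prop :=
  forall x, exists y, forall z, inn z y <-> exists2 u, inn u x & inn z u.

Definition Infinity : Prop :=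
  exists x,
    (exists2 y, inn y x & forall z, ~ inn z y) /\
    forall y, inn y x ->
      exists2 z, inn z x & forall w, inn w z <-> inn w y \/ w = y.

Definition Powerset : Prop :=
  forall x, exists y, forall z, inn z y <-> subset z x.

Definition TransitiveContainment : Prop :=
  forall x, exists2 y, transitive_set y & subset x y.

Definition SetFoundation : Prop :=
  forall x, (exists y, inn y x) ->
    exists2 y, inn y x & forall z, inn z x -> ~ inn z y.

Definition WellOrdering : Prop := forall x, exists r, is_wellordering_of r x.

(* The valuation v supplies the parameters. *)
Definition Separation (Gamma : form -> Prop) : Prop :=
  forall phi, Gamma phi -> forall (v : nat -> M) a,
    exists b, forall x, inn x b <-> inn x a /\ sat (scons x v) phi.

(* Variable 0 is y, variable 1 is x in phi(x, y). *)
Definition Collection (Gamma : form -> Prop) : Prop :=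
  forall phi, Gamma phi -> forall (v : nat -> M) w,
    (forall x, inn x w -> exists y, sat (scons y (scons x v)) phi) ->
    exists c : M, forall x, inn x w ->
      exists2 y, inn y c & sat (scons y (scons x v)) phi.

Record Mac : Prop := {
  Mac_ext : Extensionality;
  Mac_pair : Pairing;
  Mac_empty : Emptyset;
  Mac_union : Union;
  Mac_inf : Infinity;
  Mac_pow : Powerset;
  Mac_tc : TransitiveContainment;
  Mac_sep : Separation Delta0;
  Mac_found : SetFoundation;
  Mac_wo : WellOrdering
}.

Definition MOST : Prop :=
  [/\ Mac, Separation Sigma1 & Collection Delta0].

End Theories.

(** * Recursive sets of formulas *)

(* Total recursive functions: minimisation is only applied when it yields a
   total function. *)
Inductive recursive : forall n : nat, (n.-tuple nat -> nat) -> Prop :=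
| rec_zero n : @recursive n (fun=> 0)
| rec_succ : @recursive 1 (fun v => (thead v).+1)
| rec_proj n (i : 'I_n) : @recursive n (fun v => tnth v i)
| rec_comp m n (f : m.-tuple nat -> nat) (g : 'I_m -> n.-tuple nat -> nat) :
    recursive f -> (forall i, recursive (g i)) ->
    @recursive n (fun v => f [tuple g i v | i < m])
| rec_prim n (f : n.-tuple nat -> nat) (g : n.+2.-tuple nat -> nat)
    (h : n.+1.-tuple nat -> nat) :
    recursive f -> recursive g ->
    (forall v : n.-tuple nat, h [tuple of 0 :: v] = f v) ->
    (forall k (v : n.-tuple nat),
       h [tuple of k.+1 :: v] = g [tuple of k :: h [tuple of k :: v] :: v]) ->
    recursive h
| rec_min n (f : n.+1.-tuple nat -> nat) (h : n.-tuple nat -> nat) :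
    recursive f ->
    (forall v : n.-tuple nat, f [tuple of h v :: v] = 0) ->
    (forall (v : n.-tuple nat) k, k < h v -> f [tuple of k :: v] <> 0) ->
    recursive h
| rec_ext n (f g : n.-tuple nat -> nat) :
    recursive f -> f =1 g -> recursive g.

Definition recursive_set (A : nat -> Prop) : Prop :=
  exists chi : 1.-tuple nat -> nat,
    recursive chi /\
    forall k, (A k -> chi [tuple k] = 1) /\ (~ A k -> chi [tuple k] = 0).

(* Cantor pairing. *)
Definition cpair (a b : nat) : nat := 'C((a + b).+1, 2) + b.

Fixpoint godel (phi : form) : nat :=
  match phi with
  | fEq i j => cpair 0 (cpair i j)
  | fIn i j => cpair 1 (cpair i j)
  | fNeg f => cpair 2 (godel f)
  | fAnd f g => cpair 3 (cpair (godel f) (godel g))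
  | fOr f g => cpair 4 (cpair (godel f) (godel g))
  | fImp f g => cpair 5 (cpair (godel f) (godel g))
  | fAll f => cpair 6 (godel f)
  | fEx f => cpair 7 (godel f)
  end.

Definition recursive_forms (p : form -> Prop) : Prop :=
  recursive_set (fun k => exists2 phi, p phi & godel phi = k).

(** * Recursive saturation *)

(* Variables 0, ..., n-1 are read in x; variable n+i is read at a i. *)
Definition vcat (T : Type) (n : nat) (x a : nat -> T) (i : nat) : T :=
  if i < n then x i else a (i - n).

(* A type p(x_0, ..., x_(n-1); a_0, ..., a_(k-1)).  Since free variables are
   below n + k, only the first n values of x and the first k values of a
   matter. *)
Definition recursively_saturated (M : structure) : Prop :=
  forall (n k : nat) (a : nat -> M) (p : form -> Prop),
    recursive_forms p ->
    (forall phi, p phi -> fv_below (n + k) phi) ->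
    (forall s : seq form, (forall phi, List.In phi s -> p phi) ->
       exists x : nat -> M,
         forall phi, List.In phi s -> sat (vcat n x a) phi) ->
    exists x : nat -> M, forall phi, p phi -> sat (vcat n x a) phi.

(** * Embeddings and cuts *)

Definition countable_structure (M : structure) : Prop :=
  exists f : M -> nat, injective f.

Definition embedding (M N : structure) (h : M -> N) : Prop :=
  injective h /\ forall x y : M, inn x y <-> inn (h x) (h y).

Definition range (S T : Type) (h : S -> T) (y : T) : Prop :=
  exists x, h x = y.

Definition substructure (B : structure) (A : B -> Prop) : structure :=
  @Structure {x : B | A x} (fun x y => inn (proj1_sig x) (proj1_sig y)).

(* Ord^A, as a subset of B. *)
Definition Ord_of (B : structure) (A : B -> Prop) (x : B) : Prop :=
  exists2 a : substructure A, is_ordinal a & proj1_sig a = x.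

Definition end_extension (B : structure) (A : B -> Prop) : Prop :=
  forall x y : B, A y -> inn x y -> A x.

Definition powerset_preserving (B : structure) (A : B -> Prop) : Prop :=
  end_extension A /\ forall x y : B, A y -> subset x y -> A x.

Definition topless (B : structure) (A : B -> Prop) : Prop :=
  [/\ end_extension A,
      exists x : B, ~ A x
    & forall c : B, (forall x, inn x c -> Ord_of A x) -> A c].

Definition H_cut (M : structure) (I : M -> Prop) : Prop :=
  [/\ powerset_preserving I, topless I & MOST (substructure I)].

(* Main.v *)
(** We build [h] by a back-and-forth construction along finite sets of pairs
    [(u_i, v_i)] together with a transitive set [B], preserving, for every
    [Delta0P] formula [phi],
      [(exists x, phi(x, u)) -> (exists x \in B, phi(x, v))].
    Recursive saturation turns each extension step into a finite one: a new [u]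
    is matched because finitely many witnesses fit into one set, and an element
    or subset of some [v_i] gets a preimage by [Delta0P]-collection.  The bound
    [B] may moreover be replaced by smaller ones, so that every [c] in [M] is
    either put into the range or fails to be included in it; this gives
    toplessness, for all sets and not only for sets of ordinals.  The range is
    isomorphic to [M], hence a model of [MOST]. *)

From Stdlib Require Import Classical ClassicalEpsilon.
From mathcomp Require Import all_boot zify.
Require Import Defs.

Set Implicit Arguments.
Unset Strict Implicit.
Unset Printing Implicit Defensive.

(** * Recursive functions *)

Definition rec1 (f : nat -> nat) : Prop :=
  recursive (fun v : 1.-tuple nat => f (thead v)).
Definition rec2 (f : nat -> nat -> nat) : Prop :=
  recursive (fun v : 2.-tuple nat => f (tnth v ord0) (tnth v ord_max)).
Definition rec3 (f : nat -> nat -> nat -> nat) : Prop :=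
  recursive (fun v : 3.-tuple nat =>
    f (tnth v ord0) (tnth v (lift ord0 ord0)) (tnth v ord_max)).

Lemma rec_app1 n f (F : n.-tuple nat -> nat) :
  rec1 f -> recursive F -> recursive (fun v => f (F v)).
Proof.
move=> hf hF; have := rec_comp hf (fun _ : 'I_1 => hF).
by move/rec_ext; apply=> v; rewrite /thead tnth_mktuple.
Qed.

Lemma rec_app2 n f (F G : n.-tuple nat -> nat) :
  rec2 f -> recursive F -> recursive G -> recursive (fun v => f (F v) (G v)).
Proof.
move=> hf hF hG.
have := @rec_comp 2 n _ (fun i => if i == ord0 then F else G) hf.
move=> H; apply: rec_ext (H _) _ => [i|v]; first by case: ifP.
by rewrite !tnth_mktuple.
Qed.

Lemma rec_S n (F : n.-tuple nat -> nat) :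
  recursive F -> recursive (fun v => (F v).+1).
Proof. exact: rec_app1 rec_succ. Qed.

Lemma rec_const n c : @recursive n (fun=> c).
Proof. by elim: c => [|c IH]; [exact: rec_zero | exact: rec_S]. Qed.

Lemma rec1_id : rec1 id. Proof. exact: rec_proj. Qed.

Lemma rec_prim1 c g h :
  rec2 g -> h 0 = c -> (forall k, h k.+1 = g k (h k)) -> rec1 h.
Proof.
move=> hg h0 hS.
apply: (@rec_prim 0 (fun=> c)
  (fun v => g (tnth v ord0) (tnth v ord_max))) => //.
- exact: rec_const.
- by move=> k v; exact: hS.
Qed.

Lemma rec_prim2 f g h :
  rec1 f -> rec3 g -> (forall x, h 0 x = f x) ->
  (forall k x, h k.+1 x = g k (h k x) x) -> rec2 h.
Proof.
move=> hf hg h0 hS.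
apply: (@rec_prim 1 (fun v => f (thead v)) (fun v => g (tnth v ord0)
    (tnth v (lift ord0 ord0)) (tnth v ord_max))) => //.
- by case/tupleP=> x v; exact: h0.
- by move=> k; case/tupleP=> x v; exact: hS.
Qed.

Lemma rec2_proj1 : rec2 (fun x _ => x). Proof. exact: rec_proj. Qed.

Lemma rec1_pred : rec1 predn.
Proof. exact: (@rec_prim1 0 (fun k _ => k)) rec2_proj1 _ _. Qed.

Lemma rec2_add : rec2 addn.
Proof.
apply: (@rec_prim2 id (fun _ r _ => r.+1)) => //; first exact: rec1_id.
exact/rec_S/rec_proj.
Qed.

Lemma rec2_mul : rec2 muln.
Proof.
apply: (@rec_prim2 (fun=> 0) (fun _ r x => x + r)) => [|||k x].
- exact: rec_const.
- by apply: rec_app2 rec2_add _ _; exact: rec_proj.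
- by [].
- exact: mulSn.
Qed.

Lemma rec2_sub : rec2 subn.
Proof.
(* Primitive recursion runs on the first argument, so the subtrahend is put first. *)
have H : rec2 (fun k x => x - k).
  apply: (@rec_prim2 id (fun _ r _ => r.-1)) => [|||k x].
  - exact: rec1_id.
  - by apply: rec_app1 rec1_pred _; exact: rec_proj.
  - by move=> x; rewrite subn0.
  - by rewrite subnS.
by apply: (rec_app2 H); exact: rec_proj.
Qed.

Section Closure.
Variable n : nat.
Implicit Types F G K : n.-tuple nat -> nat.

Lemma rec_pred F : recursive F -> recursive (fun v => (F v).-1).
Proof. exact: rec_app1 rec1_pred. Qed.
Lemma rec_add F G :
  recursive F -> recursive G -> recursive (fun v => F v + G v).
Proof. exact: rec_app2 rec2_add. Qed.
Lemma rec_mul F G :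
  recursive F -> recursive G -> recursive (fun v => F v * G v).
Proof. exact: rec_app2 rec2_mul. Qed.
Lemma rec_sub F G :
  recursive F -> recursive G -> recursive (fun v => F v - G v).
Proof. exact: rec_app2 rec2_sub. Qed.

Lemma rec_max F G :
  recursive F -> recursive G -> recursive (fun v => maxn (F v) (G v)).
Proof.
move=> hF hG; apply: rec_ext (rec_add hF (rec_sub hG hF)) _ => v.
by rewrite maxnE.
Qed.

Lemma rec_leq F G :
  recursive F -> recursive G -> recursive (fun v => nat_of_bool (F v <= G v)).
Proof.
move=> hF hG; apply: rec_ext (rec_sub (rec_const n 1) (rec_sub hF hG)) _ => v.
by rewrite /leq; case: (F v - G v).
Qed.

Lemma rec_and F G :
  recursive F -> recursive G -> recursive (fun v => nat_of_bool ((F v != 0) && (G v != 0))).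
Proof.
move=> hF hG; apply: rec_ext (rec_leq (rec_const n 1) (rec_mul hF hG)) _ => v.
by rewrite muln_gt0 !lt0n.
Qed.

Lemma rec_eq F G :
  recursive F -> recursive G -> recursive (fun v => nat_of_bool (F v == G v)).
Proof.
move=> hF hG; apply: rec_ext (rec_and (rec_leq hF hG) (rec_leq hG hF)) _ => v.
by rewrite !eqb0 !negbK eqn_leq.
Qed.

Lemma rec_if (b : n.-tuple nat -> bool) F G :
  recursive (fun v => nat_of_bool (b v)) -> recursive F -> recursive G ->
  recursive (fun v => if b v then F v else G v).
Proof.
move=> hb hF hG.
apply: rec_ext (rec_add (rec_mul hb hF)
  (rec_mul (rec_sub (rec_const n 1) hb) hG)) _ => v.
by case: (b v); rewrite ?mul1n ?mul0n ?addn0.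
Qed.

End Closure.

(** * The Cantor pairing and its inverse *)

(** The triangular number 0 + 1 + ... + s, which is the Cantor code of [(s, 0)], the first pair on
    the diagonal of sum [s]. *)
Definition triangle (s : nat) : nat := 'C(s.+1, 2).

Lemma triangleS s : triangle s.+1 = triangle s + s.+1.
Proof. by rewrite /triangle binS bin1. Qed.

Lemma leq_triangle s : s <= triangle s.
Proof. by elim: s => // s IH; rewrite triangleS; lia. Qed.

Lemma triangle_mono s t : s <= t -> triangle s <= triangle t.
Proof.
move=> /subnK <-; elim: (t - s) => // k IH.
by rewrite addSn triangleS; lia.
Qed.

(** The diagonal of the pair coded by [n], that is, the largest [s] with [triangle s <= n]. It grows
    by one exactly when [n] reaches the next triangular number, so primitive recursion computes it
    without search. *)
Fixpoint cdiag (n : nat) : nat :=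
  if n is k.+1 then cdiag k + (triangle (cdiag k).+1 <= k.+1) else 0.

Definition csnd (n : nat) : nat := n - triangle (cdiag n).
Definition cfst (n : nat) : nat := cdiag n - csnd n.

Lemma cdiagP n : triangle (cdiag n) <= n < triangle (cdiag n).+1.
Proof.
elim: n => // n /= /andP[h1 h2].
move: (triangleS (cdiag n).+1); case: (leqP (triangle (cdiag n).+1) n.+1) => h e.
- by rewrite addn1 h e /=; lia.
- by rewrite addn0; lia.
Qed.

(** The code lies between the triangular numbers of [a + b] and of its successor, and such intervals
    are disjoint. *)
Lemma cdiag_cpair a b : cdiag (cpair a b) = a + b.
Proof.
have /andP[h1 h2] := cdiagP (cpair a b).
have e1 := triangleS (a + b).
have e2 : cpair a b = triangle (a + b) + b by [].
case: (ltngtP (cdiag (cpair a b)) (a + b)) => // h.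
- by have := triangle_mono h; lia.
- by have := triangle_mono h; lia.
Qed.

Lemma csnd_cpair a b : csnd (cpair a b) = b.
Proof. by rewrite /csnd cdiag_cpair /cpair /triangle addKn. Qed.

Lemma cfst_cpair a b : cfst (cpair a b) = a.
Proof. by rewrite /cfst cdiag_cpair csnd_cpair addnK. Qed.

Lemma cdiag_le n : cdiag n <= n.
Proof. by have /andP[h _] := cdiagP n; apply: leq_trans (leq_triangle _) h. Qed.

Lemma cfst_le n : cfst n <= n.
Proof. by have := cdiag_le n; rewrite /cfst; lia. Qed.

Lemma csnd_le n : csnd n <= n.
Proof. by rewrite /csnd; lia. Qed.

(** This strict decrease lets the enumeration below recurse on the components of a tagged code. *)
Lemma csnd_lt n : 0 < cfst n -> csnd n < n.
Proof.
move=> h; have s0 : 0 < cdiag n by move: h; rewrite /cfst; lia.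
have := leq_triangle (cdiag n); have := cdiag_le n.
by rewrite /csnd; lia.
Qed.

Lemma ltn_cpair a b : 0 < a -> b < cpair a b.
Proof.
by move=> a0; rewrite -{1}(csnd_cpair a b); apply: csnd_lt; rewrite cfst_cpair.
Qed.

Lemma leq_cpair_r a b : b <= cpair a b.
Proof. exact: leq_addl. Qed.

Lemma leq_cpair_l a b : a <= cpair a b.
Proof.
have := leq_triangle (a + b); rewrite /cpair -/(triangle (a + b)); lia.
Qed.

Lemma rec1_triangle : rec1 triangle.
Proof.
apply: (@rec_prim1 0 (fun k r => r + k.+1)) => //; last exact: triangleS.
by apply: rec_add; [|apply: rec_S]; exact: rec_proj.
Qed.

Lemma rec1_cdiag : rec1 cdiag.
Proof.
apply: (@rec_prim1 0 (fun k r => r + (triangle r.+1 <= k.+1))) => //.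
apply: rec_add; first exact: rec_proj.
apply: rec_leq; last by apply: rec_S; exact: rec_proj.
by apply: (rec_app1 rec1_triangle); apply: rec_S; exact: rec_proj.
Qed.

Section PairClosure.
Variable n : nat.
Implicit Types F G : n.-tuple nat -> nat.

Lemma rec_cpair F G :
  recursive F -> recursive G -> recursive (fun v => cpair (F v) (G v)).
Proof.
move=> hF hG; apply: (rec_add _ hG).
exact: (rec_app1 rec1_triangle (rec_add hF hG)).
Qed.

Lemma rec_csnd F : recursive F -> recursive (fun v => csnd (F v)).
Proof.
move=> hF; apply: rec_sub => //; apply: (rec_app1 rec1_triangle).
exact: (rec_app1 rec1_cdiag).
Qed.

Lemma rec_cfst F : recursive F -> recursive (fun v => cfst (F v)).
Proof.
by move=> hF; apply: rec_sub; [exact: (rec_app1 rec1_cdiag)|exact: rec_csnd].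
Qed.

End PairClosure.

Lemma rec2_iter f : rec1 f -> rec2 (fun k x => iter k f x).
Proof.
move=> hf; apply: (@rec_prim2 id (fun _ r _ => f r)) => //.
- exact: rec1_id.
- by apply: (rec_app1 hf); exact: rec_proj.
Qed.

(* Keeps conversion from evaluating binomial coefficients. *)
Local Opaque cpair.

(** * An enumeration of the bounded formulas *)

(* [hist n] lists, most recent first, the values already computed at
   [n.-1, ..., 0]; [recall n h x] is the one computed at [x]. *)
Definition recall (n h x : nat) : nat := cfst (iter (n.-1 - x) csnd h).

(** The Goedel number of [fSub i j]. *)
Definition subCode (i j : nat) : nat :=
  cpair 6 (cpair 5 (cpair (cpair 1 (cpair 0 i.+1)) (cpair 1 (cpair 0 j.+1)))).

(* A value is a pair: the Goedel number of a formula, a bound on its free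
   variables. *)
Definition enum_step (n h : nat) : nat :=
  let t := cfst n in let m := csnd n in
  let i := cfst m in let j := csnd m in
  let A := recall n h m in let L := recall n h i in let R := recall n h j in
  let qbound := maxn i.+1 (csnd R).-1 in
  let code q c b := cpair (cpair q (cpair c (cpair b (cfst R)))) qbound in
  if t <= 1 then cpair (cpair t (cpair i j)) (maxn i.+1 j.+1)
  else if t == 2 then cpair (cpair 2 (cfst A)) (csnd A)
  else if t <= 5 then
    cpair (cpair t (cpair (cfst L) (cfst R))) (maxn (csnd L) (csnd R))
  else if t == 6 then code 7 3 (cpair 1 (cpair 0 i.+1))
  else if t == 7 then code 6 5 (cpair 1 (cpair 0 i.+1))
  else if t == 8 then code 7 3 (subCode 0 i.+1)
  else code 6 5 (subCode 0 i.+1).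

Fixpoint hist (n : nat) : nat :=
  if n is k.+1 then cpair (enum_step k (hist k)) (hist k) else 0.

(** Course-of-values recursion. The tag [cfst n] selects a clause of [Delta0P]: 0 to 5 for atoms and
    connectives, 6 and 7 for quantifiers bounded by membership, 8 and anything larger for those
    bounded by inclusion. Thus every number codes some formula. *)
Definition enumP (n : nat) : nat := enum_step n (hist n).

(** Each [csnd] drops the most recent entry, so [n.-1 - x] of them leave [hist x.+1], whose head is
    the value at [x]. *)
Lemma recall_hist n x : x < n -> recall n (hist n) x = enumP x.
Proof.
move=> xn; rewrite /recall.
have -> : iter (n.-1 - x) csnd (hist n) = hist x.+1.
  rewrite -{2}(subnK xn); have -> : n.-1 - x = n - x.+1 by lia.
  elim: (n - x.+1) => // k IH.
  by rewrite iterSr addSn /= csnd_cpair IH.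
by rewrite /= cfst_cpair.
Qed.

Lemma rec_recall n (N H X : n.-tuple nat -> nat) :
  recursive N -> recursive H -> recursive X ->
  recursive (fun v => recall (N v) (H v) (X v)).
Proof.
move=> hN hH hX; apply: rec_cfst.
have hc : rec1 csnd by apply: rec_csnd; exact: rec1_id.
by apply: (rec_app2 (rec2_iter hc)) => //; apply: rec_sub => //; exact: rec_pred.
Qed.

Ltac recsolve := repeat
  lazymatch goal with
  | |- recursive (fun v => cpair _ _) => apply: rec_cpair
  | |- recursive (fun v => nat_of_bool (_ == _)) => apply: rec_eq
  | |- recursive (fun v => nat_of_bool (_ <= _)) => apply: rec_leq
  | |- recursive (fun v => if _ then _ else _) => apply: rec_if
  | |- recursive (fun v => maxn _ _) => apply: rec_max
  | |- recursive (fun v => S _) => apply: rec_S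
  | |- recursive (fun v => predn _) => apply: rec_pred
  | |- recursive (fun v => cfst _) => apply: rec_cfst
  | |- recursive (fun v => csnd _) => apply: rec_csnd
  | |- recursive (fun v => recall _ _ _) => apply: rec_recall
  | |- recursive (fun v => 0) => apply: rec_zero
  | |- recursive _ => assumption
  end.

Lemma rec_enum_step k (N H : k.-tuple nat -> nat) :
  recursive N -> recursive H -> recursive (fun v => enum_step (N v) (H v)).
Proof. by move=> hN hH; rewrite /enum_step /subCode; cbv zeta; recsolve. Qed.

Lemma rec1_hist : rec1 hist.
Proof.
apply: (@rec_prim1 0 (fun k r => cpair (enum_step k r) r)) => //.
by apply: rec_cpair; [apply: rec_enum_step|]; exact: rec_proj.
Qed.

Lemma rec_enumP n (F : n.-tuple nat -> nat) :
  recursive F -> recursive (fun v => enumP (F v)).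
Proof.
by move=> hF; apply: rec_enum_step => //; exact: (rec_app1 rec1_hist).
Qed.

Lemma fv_below_mono phi m n : m <= n -> fv_below m phi -> fv_below n phi.
Proof.
elim: phi m n => [i j|i j|f IH|f IHf g IHg|f IHf g IHg|f IHf g IHg|f IH|f IH]
  m n mn /=; try by (move/andP=> [h1 h2]; apply/andP; split; lia).
- exact: IH.
- by case/andP=> /(IHf _ _ mn) -> /(IHg _ _ mn) ->.
- by case/andP=> /(IHf _ _ mn) -> /(IHg _ _ mn) ->.
- by case/andP=> /(IHf _ _ mn) -> /(IHg _ _ mn) ->.
- by apply: IH.
- by apply: IH.
Qed.

Lemma enumP_sound n : exists phi,
  [/\ Delta0P phi, fv_below (csnd (enumP n)) phi & cfst (enumP n) = godel phi].
Proof.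
elim/ltn_ind: n => n IH.
rewrite /enumP /enum_step; set t := cfst n; set m := csnd n.
set i := cfst m; set j := csnd m.
(* Only tags above 1 recurse, and for these the components are smaller than [n]. *)
have lt x : 1 < t -> x <= m -> x < n.
  by move=> ht hx; apply: leq_ltn_trans hx _; apply: csnd_lt; lia.
have im : i <= m := cfst_le m.
have jm : j <= m := csnd_le m.
case: leqP => [t1|t1].
  rewrite cfst_cpair csnd_cpair.
  have [->|->] : t = 0 \/ t = 1 by lia.
  - by exists (fEq i j); split; [constructor|rewrite /=; lia|].
  - by exists (fIn i j); split; [constructor|rewrite /=; lia|].
have {}lt x := lt x t1.
rewrite !recall_hist ?lt //.
case: eqP => [_|t2].
  have [f [hf bf ->]] := IH m (lt m (leqnn m)).
  exists (fNeg f); rewrite cfst_cpair csnd_cpair; split=> //; exact: Delta0P_Neg.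
have [f [hf bf ->]] := IH i (lt i im).
have [g [hg bg ->]] := IH j (lt j jm).
case: leqP => [t5|t5].
  rewrite cfst_cpair csnd_cpair.
  have bb : fv_below (maxn (csnd (enumP i)) (csnd (enumP j))) f &&
            fv_below (maxn (csnd (enumP i)) (csnd (enumP j))) g.
    by rewrite (fv_below_mono _ bf) ?leq_maxl // (fv_below_mono _ bg) ?leq_maxr.
  have [->|[->|->]] : t = 3 \/ t = 4 \/ t = 5 by lia.
  - by exists (fAnd f g); split=> //; exact: Delta0P_And.
  - by exists (fOr f g); split=> //; exact: Delta0P_Or.
  - by exists (fImp f g); split=> //; exact: Delta0P_Imp.
(* The bound of the body drops by one under the quantifier; [i.+1] makes room for the bounding
   variable, which lives outside. *)
set b := maxn _ _.
have bb : fv_below b.+1 g by apply: fv_below_mono bg; rewrite /b; lia.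
have ib : i < b by rewrite /b; lia.
case: eqP => [_|t6]; last case: eqP => [_|t7]; last case: eqP => [_|t8];
  rewrite cfst_cpair csnd_cpair.
- by exists (fExIn i g); split=> //; [exact: Delta0P_ExIn | rewrite /= bb; lia].
- by exists (fAllIn i g); split=> //; [exact: Delta0P_AllIn | rewrite /= bb; lia].
- by exists (fExSub i g); split=> //; [exact: Delta0P_ExSub | rewrite /= bb; lia].
- by exists (fAllSub i g); split=> //; [exact: Delta0P_AllSub | rewrite /= bb; lia].
Qed.

Lemma enumP_unfold t m : 1 < t ->
  enumP (cpair t m) =
    let i := cfst m in let j := csnd m in
    let A := enumP m in let L := enumP i in let R := enumP j in
    let qbound := maxn i.+1 (csnd R).-1 in
    let code q c b := cpair (cpair q (cpair c (cpair b (cfst R)))) qbound in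
    if t == 2 then cpair (cpair 2 (cfst A)) (csnd A)
    else if t <= 5 then
      cpair (cpair t (cpair (cfst L) (cfst R))) (maxn (csnd L) (csnd R))
    else if t == 6 then code 7 3 (cpair 1 (cpair 0 i.+1))
    else if t == 7 then code 6 5 (cpair 1 (cpair 0 i.+1))
    else if t == 8 then code 7 3 (subCode 0 i.+1)
    else code 6 5 (subCode 0 i.+1).
Proof.
move=> t1; rewrite {1}/enumP /enum_step cfst_cpair csnd_cpair.
have lt x : x <= m -> x < cpair t m.
  by move=> h; apply: leq_ltn_trans h _; apply: ltn_cpair; lia.
have := cfst_le m; have := csnd_le m => jm im.
by rewrite !recall_hist ?lt // [t <= 1]leqNgt t1.
Qed.

(** Allowing every admissible [N] ensures that keeping only the codes with recorded bound at most
    [N] loses no formula. *)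
Lemma enumP_complete phi N : Delta0P phi -> fv_below N phi ->
  exists2 n, cfst (enumP n) = godel phi & csnd (enumP n) <= N.
Proof.
move=> hphi; elim: hphi N =>
  [i j|i j|f _ IH|f g _ IHf _ IHg|f g _ IHf _ IHg|f g _ IHf _ IHg
  |j f _ IH|j f _ IH|j f _ IH|j f _ IH] N.
- move=> /= h; exists (cpair 0 (cpair i j));
    by rewrite /enumP /enum_step !(cfst_cpair, csnd_cpair) //=; lia.
- move=> /= h; exists (cpair 1 (cpair i j));
    by rewrite /enumP /enum_step !(cfst_cpair, csnd_cpair) //=; lia.
- move=> /IH[n e b]; exists (cpair 2 n);
    by rewrite enumP_unfold //= !(cfst_cpair, csnd_cpair) // e.
- move=> /= /andP[/IHf[n e b] /IHg[m e' b']]; exists (cpair 3 (cpair n m));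
    by rewrite enumP_unfold //= !(cfst_cpair, csnd_cpair) ?e ?e' // geq_max b.
- move=> /= /andP[/IHf[n e b] /IHg[m e' b']]; exists (cpair 4 (cpair n m));
    by rewrite enumP_unfold //= !(cfst_cpair, csnd_cpair) ?e ?e' // geq_max b.
- move=> /= /andP[/IHf[n e b] /IHg[m e' b']]; exists (cpair 5 (cpair n m));
    by rewrite enumP_unfold //= !(cfst_cpair, csnd_cpair) ?e ?e' // geq_max b.
- move=> /= /andP[h /IH[n e b]]; exists (cpair 6 (cpair j n));
    by rewrite enumP_unfold //= !(cfst_cpair, csnd_cpair) ?e //; lia.
- move=> /= /andP[h /IH[n e b]]; exists (cpair 7 (cpair j n));
    by rewrite enumP_unfold //= !(cfst_cpair, csnd_cpair) ?e //; lia.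
- move=> /= /andP[h /IH[n e b]]; exists (cpair 8 (cpair j n));
    by rewrite enumP_unfold //= !(cfst_cpair, csnd_cpair) ?e //; lia.
- move=> /= /andP[h /IH[n e b]]; exists (cpair 9 (cpair j n));
    by rewrite enumP_unfold //= !(cfst_cpair, csnd_cpair) ?e //; lia.
Qed.

(** * Saturation for schemes over the bounded formulas *)

(* A true conjunct of Goedel number at least [n]: it makes the range of a
   recursive enumeration of formulas decidable. *)
Fixpoint padF (n : nat) : form :=
  if n is k.+1 then fAnd (fEq 0 0) (padF k) else fEq 0 0.

Lemma sat_padF (M : structure) (v : nat -> M) n : sat v (padF n).
Proof. by elim: n => //= n IH. Qed.

Lemma fv_below_padF n k : fv_below k.+1 (padF n).
Proof. by elim: n. Qed.

Lemma leq_godel_padF n : n <= godel (padF n).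
Proof.
elim: n => //= n IH; apply: leq_ltn_trans IH _.
by apply: leq_ltn_trans (ltn_cpair _ _); [exact: leq_cpair_r|].
Qed.

Lemma rec1_padF : rec1 (fun n => godel (padF n)).
Proof.
apply: (@rec_prim1 _ (fun _ r => cpair 3 (cpair (godel (fEq 0 0)) r))) => //.
by apply: rec_cpair; last apply: rec_cpair; [exact: rec_const..|exact: rec_proj].
Qed.

(** Each instance carries a code [n] of [phi]. The bound occurs both as [fv_below], for use, and as
    a condition on [enumP n], which a recursive test can check. *)
Definition scheme (N : nat) (T : form -> form) (psi : form) : Prop :=
  exists n phi, [/\ Delta0P phi, fv_below N phi, cfst (enumP n) = godel phi,
    csnd (enumP n) <= N & psi = fAnd (padF n) (T phi)].

(** The padding makes the Goedel number of an instance at least its code [n], so membership of [k]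
    is decided by a search bounded by [k]. *)
Lemma recursive_scheme N T c :
  rec1 c -> (forall phi, godel (T phi) = c (godel phi)) ->
  recursive_forms (scheme N T).
Proof.
move=> hc hT.
pose code n := cpair 3 (cpair (godel (padF n)) (c (cfst (enumP n)))).
pose test n k := (csnd (enumP n) <= N) && (code n == k).
pose search := fix search n k :=
  if n is n'.+1 then if test n' k then 1 else search n' k else 0.
have hsearch : rec2 search.
  apply: (@rec_prim2 (fun=> 0) (fun n r k =>
     if csnd (enumP n) <= N then if code n == k then 1 else r else r)) => //.
  - exact: rec_const.
  - pose n (v : 3.-tuple nat) := tnth v ord0.
    have hn : recursive (fun v => n v) by exact: rec_proj.
    have he := rec_enumP hn.
    have hcode : recursive (fun v => code (n v)).
      apply: rec_cpair; first exact: rec_const.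
      apply: rec_cpair; first exact: rec_app1 rec1_padF hn.
      by apply: rec_app1 hc _; exact: rec_cfst.
    apply: rec_if; last by exact: rec_proj.
      by apply: rec_leq; [exact: rec_csnd|exact: rec_const].
    apply: rec_if; [|exact: rec_const|exact: rec_proj].
    by apply: rec_eq => //; exact: rec_proj.
  - by move=> n k /=; rewrite /test; case: (_ <= N).
have searchP n k : reflect (exists2 i, i < n & test i k) (search n k == 1).
  elim: n => [|n IH] /=; first by right; case.
  case: ifP => h; first by left; exists n.
  apply: (iffP IH) => [[i lt ti]|[i lt ti]]; exists i => //; first by lia.
  have [//|e] : i < n \/ i = n by lia.
  by rewrite e h in ti.
have search01 n k : search n k = 0 \/ search n k = 1.
  by elim: n => [|n IH] /=; [left|case: ifP; [right|]].
(* Codes up to and including [k] are tested, hence the successor. *)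
exists (fun v => search (thead v).+1 (thead v)); split.
  by apply: (rec_app2 hsearch); [apply: rec_S|]; exact: rec_proj.
move=> k; rewrite theadE; split.
- case=> psi [n [phi [h1 h2 h3 h4 ->]]] e; apply/eqP/searchP.
  have e' : code n = k by rewrite -e /code h3 -hT.
  exists n; last by rewrite /test h4 e' /=.
  rewrite ltnS -e'; apply: leq_trans (leq_godel_padF n) _.
  by apply: leq_trans (leq_cpair_r _ _); exact: leq_cpair_l.
- move=> nA; case: (search01 k.+1 k) => // /eqP/searchP[n _ /andP[h1 /eqP h2]].
  case: nA; have [phi [p1 p2 p3]] := enumP_sound n.
  exists (fAnd (padF n) (T phi)); last by rewrite -h2 /code p3 -hT.
  by exists n, phi; split=> //; apply: fv_below_mono p2.
Qed.

(** * Satisfaction under renaming and binding of variables; saturation *)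

Section Saturation.
Variable M : structure.
Implicit Types (v w : nat -> M) (x y z a b c : M).

Lemma sat_ext n phi v w :
  (forall i, i < n -> v i = w i) -> fv_below n phi -> sat v phi <-> sat w phi.
Proof.
elim: phi n v w => [i j|i j|f IH|f IHf g IHg|f IHf g IHg|f IHf g IHg|f IH|f IH]
  n v w e /=.
- by case/andP=> hi hj; rewrite !e.
- by case/andP=> hi hj; rewrite !e.
- by move=> /(IH _ _ _ e) ->.
- by case/andP=> /(IHf _ _ _ e) -> /(IHg _ _ _ e) ->.
- by case/andP=> /(IHf _ _ _ e) -> /(IHg _ _ _ e) ->.
- by case/andP=> /(IHf _ _ _ e) -> /(IHg _ _ _ e) ->.
- move=> h; have H x : sat (scons x v) f <-> sat (scons x w) f.
    by apply: IH h => -[|i] //=; exact: e.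
  by split=> hx x; apply/H.
- move=> h; have H x : sat (scons x v) f <-> sat (scons x w) f.
    by apply: IH h => -[|i] //=; exact: e.
  by split=> -[x /H hx]; exists x.
Qed.

Fixpoint frename (r : nat -> nat) (phi : form) : form :=
  let up r i := if i is j.+1 then (r j).+1 else 0 in
  match phi with
  | fEq i j => fEq (r i) (r j)
  | fIn i j => fIn (r i) (r j)
  | fNeg f => fNeg (frename r f)
  | fAnd f g => fAnd (frename r f) (frename r g)
  | fOr f g => fOr (frename r f) (frename r g)
  | fImp f g => fImp (frename r f) (frename r g)
  | fAll f => fAll (frename (up r) f)
  | fEx f => fEx (frename (up r) f)
  end.

(** Lets valuations be compared pointwise, with no appeal to functional extensionality. *)
Lemma sat_any_ext phi v w : v =1 w -> sat v phi <-> sat w phi.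
Proof.
move=> e; have [n hn] : exists n, fv_below n phi.
  elim: phi => [i j|i j|f [n h]|f [n h] g [m k]|f [n h] g [m k]|f [n h] g [m k]
    |f [n h]|f [n h]].
  - by exists (i + j).+1 => /=; lia.
  - by exists (i + j).+1 => /=; lia.
  - by exists n.
  - by exists (n + m); rewrite /= (fv_below_mono _ h) ?(fv_below_mono _ k) //; lia.
  - by exists (n + m); rewrite /= (fv_below_mono _ h) ?(fv_below_mono _ k) //; lia.
  - by exists (n + m); rewrite /= (fv_below_mono _ h) ?(fv_below_mono _ k) //; lia.
  - by exists n; apply: fv_below_mono h.
  - by exists n; apply: fv_below_mono h.
by apply: sat_ext hn => i _.
Qed.

Lemma sat_frename phi r v : sat v (frename r phi) <-> sat (v \o r) phi.
Proof.
elim: phi r v => [i j|i j|f IH|f IHf g IHg|f IHf g IHg|f IHf g IHg|f IH|f IH]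
  r v //=.
- by rewrite IH.
- by rewrite IHf IHg.
- by rewrite IHf IHg.
- by rewrite IHf IHg.
- have H x : sat (scons x v)
      (frename (fun i => if i is j.+1 then (r j).+1 else 0) f) <->
      sat (scons x (v \o r)) f.
    by rewrite IH; apply: sat_any_ext => -[].
  by split=> h x; apply/H.
- have H x : sat (scons x v)
      (frename (fun i => if i is j.+1 then (r j).+1 else 0) f) <->
      sat (scons x (v \o r)) f.
    by rewrite IH; apply: sat_any_ext => -[].
  by split=> -[x /H h]; exists x.
Qed.

Lemma fv_below_frename phi r m n :
  (forall i, i < m -> r i < n) -> fv_below m phi -> fv_below n (frename r phi).
Proof.
elim: phi r m n => [i j|i j|f IH|f IHf g IHg|f IHf g IHg|f IHf g IHg|f IH|f IH]
  r m n hr /=.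
- by case/andP=> /hr -> /hr ->.
- by case/andP=> /hr -> /hr ->.
- exact: IH.
- by case/andP=> /(IHf _ _ _ hr) -> /(IHg _ _ _ hr) ->.
- by case/andP=> /(IHf _ _ _ hr) -> /(IHg _ _ _ hr) ->.
- by case/andP=> /(IHf _ _ _ hr) -> /(IHg _ _ _ hr) ->.
- by apply: IH => -[|i] //=; exact: hr.
- by apply: IH => -[|i] //=; exact: hr.
Qed.

Lemma Delta0P_frename phi r : Delta0P phi -> Delta0P (frename r phi).
Proof. by move=> h; elim: h r => /= *; constructor. Qed.

(* [bindF d l phi] is [phi] with its variables [i < size l] read at the outer
   variables [nth 0 (rev l) i]; unlike a renaming, it acts on Goedel numbers by
   a composition of pairings with constants. *)
Fixpoint bindF (d : nat) (l : seq nat) (phi : form) : form :=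
  if l is t :: l' then fEx (fAnd (fEq 0 (t + d).+1) (bindF d.+1 l' phi))
  else phi.

(** Each existential quantifier pins its variable to a value of [w] and so pushes that value onto
    the valuation; [d] counts the quantifiers already passed. *)
Lemma sat_bindF_foldl d l phi v w : (forall t, v (t + d) = w t) ->
  sat v (bindF d l phi) <-> sat (foldl (fun e t => scons (w t) e) v l) phi.
Proof.
elim: l d v => //= t l IH d v hv.
rewrite -(IH d.+1) => [|i]; last by rewrite addnS /= hv.
split=> [[x [-> h]]|h]; first by rewrite -hv.
by exists (w t); rewrite hv.
Qed.

(** The value pushed last is variable 0, hence the reversal. *)
Lemma foldl_scons (l : seq nat) v w i : i < size l ->
  foldl (fun e t => scons (w t) e) v l i = w (nth 0 (rev l) i).
Proof.
elim/last_ind: l i => // l t IH i; rewrite size_rcons foldl_rcons rev_rcons.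
by case: i => //= i; exact: IH.
Qed.

Lemma sat_bindF l phi v : fv_below (size l) phi ->
  sat v (bindF 0 (rev l) phi) <-> sat (fun i => v (nth 0 l i)) phi.
Proof.
move=> h; rewrite (@sat_bindF_foldl _ _ _ _ v) => [|t]; last by rewrite addn0.
by apply: sat_ext h => i hi; rewrite foldl_scons ?size_rev // revK.
Qed.

Lemma fv_below_bindF d l phi n :
  (forall t, t \in l -> t + d < n) -> fv_below (size l + n) phi ->
  fv_below n (bindF d l phi).
Proof.
elim: l d n => //= t l IH d n hl h; rewrite ltnS hl ?mem_head //=.
apply: IH => [i hi|]; last by rewrite addnS.
by rewrite addnS ltnS; apply: hl; rewrite inE hi orbT.
Qed.

Lemma godel_bindF d l :
  exists2 c, rec1 c & forall phi, godel (bindF d l phi) = c (godel phi).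
Proof.
elim: l d => [|t l IH] d; first by exists id; [exact: rec1_id|].
have [c hc e] := IH d.+1.
exists (fun k => cpair 7 (cpair 3 (cpair (godel (fEq 0 (t + d).+1)) (c k)))).
  do 3 (apply: rec_cpair; first exact: rec_const).
  exact: (rec_app1 hc rec1_id).
by move=> phi /=; rewrite e.
Qed.

Hypothesis M_recsat : recursively_saturated M.
Variable d : M.

(* The type [theta(y)] plus all implications
   [(exists x, phi(x, us)) -> exists x \in b, phi(x, vs)]; an entry [None] of
   [us], [vs] or [b] stands for the variable [y] of the type. *)
Lemma saturation (ps : seq M) theta (us vs : seq (option M)) (b : option M) :
  size us = size vs -> fv_below (size ps).+1 theta ->
  let ok phi y := (exists x, sat (nth d (x :: map (odflt y) us)) phi) ->
    exists2 x, inn x (odflt y b) & sat (nth d (x :: map (odflt y) vs)) phi in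
  (forall s, (forall phi, List.In phi s ->
      Delta0P phi /\ fv_below (size us).+1 phi) ->
    exists2 y, sat (nth d (y :: ps)) theta & forall phi, List.In phi s -> ok phi y) ->
  exists2 y, sat (nth d (y :: ps)) theta &
    forall phi, Delta0P phi -> fv_below (size us).+1 phi -> ok phi y.
Proof.
move=> szuv fvth ok fin.
(* The parameters: [ps] comes first so that [theta] keeps its variables, then every element named in
   [b], [us], [vs]. Index 0 is left to [y], so parameters are shifted by one. *)
pose ws := ps ++ pmap id (b :: us ++ vs).
pose k := size ws.
have index_of o : (forall a, o = Some a -> List.In a ws) ->
    exists2 i, i < k.+1 & forall y, nth d (y :: ws) i = odflt y o.
  case: o => [a|] h; last by exists 0.
  have [i [hi e]] := List.In_nth ws a d (h a erefl).
  exists i.+1; first by move/ltP: hi; rewrite ltnS.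
  move=> y /=; rewrite -e /=; elim: (ws) (i) => [|w ws' IH] [|j] //=.
have in_pmap a o (l : seq (option M)) :
    o = Some a -> List.In o l -> List.In a (pmap id l).
  move=> ->; elim: l => //= -[c|] l IH /= [e|/IH]; [|by right| |]=> //.
  by case: e; left.
have indices (l : seq (option M)) : (forall o, List.In o l -> List.In o (us ++ vs)) ->
    exists l' : seq nat, [/\ size l' = size l, forall i, i \in l' -> i < k.+1 &
      forall y, map (nth d (y :: ws)) l' = map (odflt y) l].
  elim: l => [|o l IH] h; first by exists [::].
  have [l' [h1 h2 h3]] := IH (fun o ho => h o (or_intror ho)).
  have [|i i1 i2] := index_of o.
    move=> a e; apply/List.in_or_app; right; apply: (in_pmap a o) => //.
    by right; apply: h; left.
  exists (i :: l'); split=> [|j|y] /=; first by rewrite h1.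
  - by rewrite inE => /orP[/eqP->|/h2].
  - by rewrite i2 h3.
have [us' [us1 us2 us3]] := indices us (fun o h => List.in_or_app _ _ _ (or_introl h)).
have [vs' [vs1 vs2 vs3]] := indices vs (fun o h => List.in_or_app _ _ _ (or_intror h)).
have [|b' b1 b2] := index_of b.
  by move=> a e; apply/List.in_or_app; right; apply: (in_pmap a b) => //; left.
(* Variable 0 of [phi] is bound to the quantified [x], the others to their indices shifted past it
   by [S]. *)
pose T phi := fAnd theta (fImp
  (fEx (bindF 0 (rev (0 :: map S us')) phi))
  (fEx (fAnd (fIn 0 b'.+1) (bindF 0 (rev (0 :: map S vs')) phi)))).
pose N := (size us).+1.
have satT phi (x : nat -> M) : fv_below N phi -> sat (vcat 1 x (nth d ws)) (T phi) <->
    sat (nth d (x 0 :: ps)) theta /\ ok phi (x 0).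
  move=> fvphi.
  have ev : vcat 1 x (nth d ws) =1 nth d (x 0 :: ws).
    by case=> [|i] //; rewrite /vcat /= subn1.
  rewrite /T (sat_any_ext _ ev) /= -/(sat _ _).
  have -> : sat (nth d (x 0 :: ws)) theta <-> sat (nth d (x 0 :: ps)) theta.
    by apply: sat_ext fvth => -[|i] //=; rewrite nth_cat ltnS => ->.
  have bindP l' l z : size l' = size us ->
      (forall y, map (nth d (y :: ws)) l' = map (odflt y) l) ->
      sat (scons z (nth d (x 0 :: ws))) (bindF 0 (rev (0 :: map S l')) phi) <->
      sat (nth d (z :: map (odflt (x 0)) l)) phi.
    move=> sz e; rewrite sat_bindF /= ?size_map ?sz //.
    apply: sat_ext fvphi => -[|i] //; rewrite /N ltnS => hi /=.
    by rewrite -e !(nth_map 0) ?sz.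
  have H1 z := bindP us' us z us1 us3.
  have H2 z := bindP vs' vs z (etrans vs1 (esym szuv)) vs3.
  rewrite /ok -b2; split=> -[h0 h]; split=> // -[z hz].
  - by have [|z' [hb /H2 h']] := h; [exists z; apply/H1 | exists z'].
  - by have [|z' hb /H2 h'] := h; [exists z; apply/H1 | exists z'].
have [c hc hT] : exists2 c, rec1 c & forall phi, godel (T phi) = c (godel phi).
  have [c1 hc1 e1] := godel_bindF 0 (rev (0 :: map S us')).
  have [c2 hc2 e2] := godel_bindF 0 (rev (0 :: map S vs')).
  exists (fun g => cpair 3 (cpair (godel theta) (cpair 5 (cpair (cpair 7 (c1 g))
    (cpair 7 (cpair 3 (cpair (godel (fIn 0 b'.+1)) (c2 g)))))))).
    do 3 (apply: rec_cpair; first exact: rec_const).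
    apply: rec_cpair; first by apply: rec_cpair (rec_const _ _) _.
    by do 3 (apply: rec_cpair; first exact: rec_const).
  by move=> phi; rewrite -e1 -e2.
have fvT phi : fv_below N phi -> fv_below (1 + k) (T phi).
  move=> h; rewrite /= add1n [b'.+1 < _]b1 (fv_below_mono _ fvth); last first.
    by rewrite ltnS /k /ws size_cat leq_addr.
  rewrite !fv_below_bindF //=.
  - move=> t; rewrite mem_rev inE addn0 => /orP[/eqP->//|/mapP[j /vs2 hj ->]] //.
  - by apply: fv_below_mono h; rewrite size_rev /= size_map vs1 -szuv /N; lia.
  - move=> t; rewrite mem_rev inE addn0 => /orP[/eqP->//|/mapP[j /us2 hj ->]] //.
  - by apply: fv_below_mono h; rewrite size_rev /= size_map us1 /N; lia.
have [|s hs|x hx] := @M_recsat 1 k (nth d ws) _ (recursive_scheme N hc hT).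
- by move=> _ [n [phi [h1 h2 _ _ ->]]] /=; rewrite fv_below_padF; exact: fvT.
(* A finite part of the type involves only finitely many [phi], to which [fin] applies. *)
- have [s' h1 h2] : exists2 s', forall phi, List.In phi s' -> Delta0P phi /\ fv_below N phi &
      forall psi, List.In psi s -> exists n phi,
        List.In phi s' /\ psi = fAnd (padF n) (T phi).
    elim: s hs => [|psi s IH] hs; first by exists [::].
    have [s' h1 h2] := IH (fun p hp => hs p (or_intror hp)).
    have [n [phi [p1 p2 _ _ ->]]] := hs psi (or_introl erefl).
    exists (phi :: s') => [p [<-//|/h1]|p] //.
    case=> [<-|/h2[n' [phi' [q1 q2]]]]; first by exists n, phi; split=> //; left.
    by exists n', phi'; split=> //; right.
  have [y y1 y2] := fin s' h1.
  exists (fun=> y) => psi /h2[n [phi [hphi ->]]]; split; first exact: sat_padF.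
  by have [_ fvphi] := h1 _ hphi; apply/satT => //; split=> //; exact: y2.
(* [theta] occurs only as a conjunct of the instances; the instance of a trivial formula recovers
   it. *)
- have [n e1 e2] := @enumP_complete (fEq 0 0) N (Delta0P_Eq 0 0) isT.
  have H n' phi : Delta0P phi -> fv_below N phi -> cfst (enumP n') = godel phi ->
      csnd (enumP n') <= N -> sat (nth d (x 0 :: ps)) theta /\ ok phi (x 0).
    move=> p1 p2 p3 p4; have [_ /satT] := hx _ (ex_intro _ n' (ex_intro _ phi
      (And5 p1 p2 p3 p4 erefl))); exact.
  exists (x 0); first by have [] := H n _ (Delta0P_Eq 0 0) isT e1 e2.
  move=> phi p1 p2; have [n' q1 q2] := enumP_complete p1 p2.
  by have [] := H n' phi p1 p2 q1 q2.
Qed.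

End Saturation.

Section BackAndForth.
Variable M : structure.
Implicit Types (v : nat -> M) (x y z a b c : M).
Hypothesis M_recsat : recursively_saturated M.
Variable d : M.

(** * Definable relations *)

(** With the closure lemmas below, relations are shown to be bounded without writing out their
    formulas. *)
Definition definable (n : nat) (R : (nat -> M) -> Prop) : Prop :=
  exists phi, [/\ Delta0P phi, fv_below n phi & forall v, sat v phi <-> R v].

Lemma definable_sat n phi :
  Delta0P phi -> fv_below n phi -> definable n (fun v => sat v phi).
Proof. by move=> h1 h2; exists phi. Qed.

Lemma definable_rename m n r R : (forall i, i < m -> r i < n) ->
  definable m R -> definable n (fun v => R (v \o r)).
Proof.
move=> hr [phi [h1 h2 h3]]; exists (frename r phi); split.
- exact: Delta0P_frename.
- exact: fv_below_frename h2.
- by move=> v; rewrite sat_frename.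
Qed.

Lemma definable_and n R S :
  definable n R -> definable n S -> definable n (fun v => R v /\ S v).
Proof.
move=> [f [f1 f2 f3]] [g [g1 g2 g3]]; exists (fAnd f g); split=> [||v] /=.
- exact: Delta0P_And.
- by rewrite f2.
- by rewrite f3 g3.
Qed.

(** A finite conjunction; the empty one is [fEq 0 0], which mentions a variable, hence [n.+1]. *)
Lemma definable_all_list T (s : seq T) n (R : T -> (nat -> M) -> Prop) :
  (forall t, List.In t s -> definable n.+1 (R t)) ->
  definable n.+1 (fun v => forall t, List.In t s -> R t v).
Proof.
elim: s => [|t s IH] h; first by exists (fEq 0 0); split=> //; constructor.
have [f [f1 f2 f3]] := h t (or_introl erefl).
have [g [g1 g2 g3]] := IH (fun t ht => h t (or_intror ht)).
exists (fAnd f g); split=> [||v] /=; [exact: Delta0P_And|by rewrite f2|].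
rewrite f3 g3; split=> [[h1 h2] t' [<-//|]|H]; first exact: h2.
by split=> [|t' ht']; apply: H; [left|right].
Qed.

Lemma definable_ex_list T (s : seq T) n (R : T -> (nat -> M) -> Prop) :
  (forall t, List.In t s -> definable n.+1 (R t)) ->
  definable n.+1 (fun v => exists2 t, List.In t s & R t v).
Proof.
elim: s => [|t s IH] h.
  exists (fNeg (fEq 0 0)); split=> // [|v /=]; first by do 2 constructor.
  by split=> [|[]].
have [f [f1 f2 f3]] := h t (or_introl erefl).
have [g [g1 g2 g3]] := IH (fun t ht => h t (or_intror ht)).
exists (fOr f g); split=> [||v] /=; [exact: Delta0P_Or|by rewrite f2|].
rewrite f3 g3; split=> [[h1|[t' ht' h1]]|[t' [<-|ht'] h1]].
- by exists t => //; left.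
- by exists t' => //; right.
- by left.
- by right; exists t'.
Qed.

Lemma definable_exin n j R : j < n -> definable n.+1 R ->
  definable n (fun v => exists2 x, inn x (v j) & R (scons x v)).
Proof.
move=> jn [f [f1 f2 f3]]; exists (fExIn j f); split=> [||v] /=.
- exact: Delta0P_ExIn.
- by rewrite f2 ltnS jn.
- by split=> [[x [h /f3]]|[x h /f3]]; exists x.
Qed.

(** The flag lets membership, for end-extension, and inclusion, for powerset preservation, share one
    argument. *)
Definition below (q : bool) x y : Prop := if q then inn x y else subset x y.

Lemma definable_allbelow q n j R : j < n -> definable n.+1 R ->
  definable n (fun v => forall x, below q x (v j) -> R (scons x v)).
Proof.
move=> jn [f [f1 f2 f3]].
exists ((if q then fAllIn else fAllSub) j f); split=> [||v] /=.
- by case: q; [exact: Delta0P_AllIn|exact: Delta0P_AllSub].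
- by case: q; rewrite /= f2 ?ltnS jn.
- by case: q; split=> h x hx; apply/f3/h.
Qed.

(** * Finite subfamilies *)

Lemma list_sub T (P : T -> Prop) (s : seq T) :
  exists s', forall t, List.In t s' <-> List.In t s /\ P t.
Proof.
elim: s => [|t s [s' IH]]; first by exists [::] => t; split=> [|[]].
case: (classic (P t)) => pt.
- exists (t :: s') => t' /=; rewrite IH.
  by split=> [[<-|[]]|[[<-|]]]; intuition.
- exists s' => t'; rewrite IH /=; split=> [[]|[[<-//|h h']]]; by intuition.
Qed.

Hypothesis M_Mac : Mac M.
Hypothesis M_Delta0P : Collection M Delta0P.

Lemma adjoin x y : exists z, inn x z /\ subset y z.
Proof.
have [s hs] := Mac_pair M_Mac x x; have [t ht] := Mac_pair M_Mac s y.
have [z hz] := Mac_union M_Mac t; exists z; split=> [|w hw]; apply/hz.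
- by exists s; [apply/ht; left|apply/hs; left].
- by exists y => //; apply/ht; right.
Qed.

(** Witnesses are adjoined one at a time, starting from a set that contains [a]. *)
Lemma finite_bound T (s : seq T) (Q : T -> M -> Prop) a :
  (forall t, List.In t s -> exists x, Q t x) ->
  exists w , inn a w /\ forall t, List.In t s -> exists2 x, inn x w & Q t x.
Proof.
elim: s => [|t s IH] h.
  by have [w [aw _]] := adjoin a a; exists w; split.
have [w [aw hw]] := IH (fun t ht => h t (or_intror ht)).
have [x hx] := h t (or_introl erefl).
have [w' [xw' ww']] := adjoin x w.
exists w'; split=> [|t' [<-|/hw[y /ww' yw' hy]]]; [exact: ww'| |].
- by exists x.
- by exists y.
Qed.

Lemma below_set q x : exists w, forall y, inn y w <-> below q y x.
Proof. by case: q; [exists x | exact: Mac_pow M_Mac x]. Qed.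

(** Foundation for the singleton of [x]. *)
Lemma inn_irrefl x : ~ inn x x.
Proof.
have [s hs] := Mac_pair M_Mac x x.
have [|y /hs e h] := Mac_found M_Mac (x := s).
  by exists x; apply/hs; left.
have {e} e : y = x by case: e.
by rewrite e in h => xx; apply: (h x) => //; apply/hs; left.
Qed.

(** * Finite partial embeddings *)

Implicit Types l : seq (M * M).

(* The pairs of [l] are [(u, h u)], and [B] bounds the range. *)
Definition good l B : Prop :=
  transitive_set B /\ forall phi, Delta0P phi -> fv_below (size l).+1 phi ->
    (exists x, sat (nth d (x :: unzip1 l)) phi) ->
    exists2 x, inn x B & sat (nth d (x :: unzip2 l)) phi.

Lemma good_definable l B R : good l B -> definable (size l).+1 R ->
  (exists x, R (nth d (x :: unzip1 l))) ->
  exists2 x, inn x B & R (nth d (x :: unzip2 l)).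
Proof.
move=> [_ h] [f [f1 f2 f3]] [x hx].
by have [|y yB /f3] := h f f1 f2; [exists x; apply/f3 | exists y].
Qed.

(** Preservation in one direction, applied to [phi] and to its negation, gives both; a dummy
    variable is first inserted for the witness. *)
Lemma good_sat l B phi : good l B -> Delta0P phi -> fv_below (size l) phi ->
  sat (nth d (unzip1 l)) phi <-> sat (nth d (unzip2 l)) phi.
Proof.
move=> gl.
have H psi : Delta0P psi -> fv_below (size l) psi ->
    sat (nth d (unzip1 l)) psi -> sat (nth d (unzip2 l)) psi.
  move=> h1 h2 h.
  have [||x _] := @good_definable l B (fun v => sat (v \o S) psi) gl.
  - apply: (@definable_rename (size l) _ S (fun v => sat v psi)) => //.
    exact: definable_sat.
  - by exists d.
  - by [].
move=> h1 h2; split; first exact: H.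
by move=> h; apply: NNPP => /(H (fNeg phi) (Delta0P_Neg h1) h2); exact.
Qed.

Lemma In_unzip l p : List.In p l ->
  exists i, [/\ i < size l, nth d (unzip1 l) i = p.1 & nth d (unzip2 l) i = p.2].
Proof.
elim: l => //= a l IH [<-|/IH[i [h1 h2 h3]]]; first by exists 0.
by exists i.+1.
Qed.

Lemma good_pairs l B p p' : good l B -> List.In p l -> List.In p' l ->
  (p.1 = p'.1 <-> p.2 = p'.2) /\ (inn p.1 p'.1 <-> inn p.2 p'.2).
Proof.
move=> gl /In_unzip[i [i1 <- <-]] /In_unzip[j [j1 <- <-]]; split.
- by apply: (@good_sat l B (fEq i j)) => //=; [constructor|rewrite i1 j1].
- by apply: (@good_sat l B (fIn i j)) => //=; [constructor|rewrite i1 j1].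
Qed.

(** Preserving the formula [x = p.1] forces the witness in [B] to be [p.2]. *)
Lemma good_range l B p : good l B -> List.In p l -> inn p.2 B.
Proof.
move=> [_ gl] /In_unzip[i [i1 e1 <-]].
have [||x xB /= <-] // := gl (fEq 0 i.+1) (Delta0P_Eq _ _).
by exists p.1.
Qed.

(** * Extension steps: forth, back, and shrinking the bound *)

Lemma map_odflt_Some y (s : seq M) : map (odflt y) (map some s) = s.
Proof. by rewrite -map_comp map_id. Qed.

(** Reads a formula on [x, y, s] in the context [x, y, c, s], where [c] is an auxiliary set bounding
    witnesses. *)
Definition rskip2 (i : nat) : nat := if i is j.+2 then j.+3 else i.

Lemma rskip2_lt n i : i < n.+2 -> rskip2 i < n.+3.
Proof. by case: i => [|[|i]]. Qed.

Lemma rskip2E x y c (s : seq M) :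
  scons x (scons y (nth d (c :: s))) \o rskip2 =1 nth d (x :: y :: s).
Proof. by case=> [|[|i]]. Qed.

(** The finitely many [phi] that have witnesses for [a] have them in one set [w] that also contains
    [a]. This is a bounded property of [w], to which goodness applies; a member of the resulting set
    in [B] serves as [b], and transitivity of [B] places the new witnesses in [B]. *)
Lemma forth l B a : good l B -> exists b, good ((a, b) :: l) B.
Proof.
move=> gl; have [tB _] := gl.
have [|||y _ hy] := @saturation M M_recsat d [::] (fEq 0 0)
  (some a :: map some (unzip1 l)) (None :: map some (unzip2 l)) (some B).
- by rewrite /= !size_map.
- by [].
- move=> s hs.
  have [s' hs'] := list_sub
    (fun phi => exists x, sat (nth d (x :: a :: unzip1 l)) phi) s.
  have [w [aw hw]] := finite_bound a (fun phi h => proj2 (proj1 (hs' phi) h)).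
  (* [v 0] is the set [w]; once [y] is pushed it moves to index 1. *)
  pose R v := exists2 y, inn y (v 0) & forall phi, List.In phi s' ->
    exists2 x, inn x (scons y v 1) & sat (scons x (scons y v) \o rskip2) phi.
  have dR : definable (size l).+1 R.
    apply: (@definable_exin _ 0 (fun v => forall phi, List.In phi s' ->
      exists2 x, inn x (v 1) & sat (scons x v \o rskip2) phi)) => //.
    apply: definable_all_list => phi /hs'[/hs[p1 p2] _].
    apply: (@definable_exin _ 1 (fun v => sat (v \o rskip2) phi)) => //.
    apply: (@definable_rename (size l).+2 _ rskip2 (fun v => sat v phi)).
      exact: rskip2_lt.
    by apply: definable_sat => //; move: p2; rewrite /= !size_map.
  have [|w' w'B [y /= yw' hy]] := good_definable gl dR.
    exists w, a => // phi /hw[x xw hx]; exists x => //.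
    by rewrite (sat_any_ext _ (rskip2E _ _ _ _)).
  exists y => // phi hphi /=; rewrite !map_odflt_Some => hx.
  have [|x xw' h] := hy phi; first exact/hs'.
  exists x; first exact: tB xw'.
  by rewrite (sat_any_ext _ (rskip2E _ _ _ _)) in h.
exists y; split=> // phi h1 h2 h3.
have := hy phi h1; rewrite /= !map_odflt_Some => H; apply: H h3.
by move: h2; rewrite /= !size_map.
Qed.

(** If finitely many formulas excluded every candidate for [a], collection would bound the witnesses
    for all candidates below [p.1] by one set. This bounded fact transfers to [p.2], where it covers
    [b] and puts a forbidden witness into [B]. *)
Lemma back q l B p b : good l B -> List.In p l -> below q b p.2 ->
  exists a, good ((a, b) :: l) B.
Proof.
move=> gl pl hb; have [tB _] := gl.
have [i [il e1 e2]] := In_unzip pl.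
have [|||y _ hy] := @saturation M M_recsat d [::] (fEq 0 0)
  (None :: map some (unzip1 l)) (some b :: map some (unzip2 l)) (some B).
- by rewrite /= !size_map.
- by [].
- move=> s hs.
  have [s' hs'] := list_sub (fun phi =>
    ~ exists2 x, inn x B & sat (nth d (x :: b :: unzip2 l)) phi) s.
  suff [y hy] : exists y, forall phi, List.In phi s' ->
      ~ exists x, sat (nth d (x :: y :: unzip1 l)) phi.
    exists y => // phi hphi /=; rewrite !map_odflt_Some => hx.
    by apply: NNPP => hn; apply: hy hx; apply/hs'.
  apply: NNPP => hn.
  pose R v := exists2 phi, List.In phi s' & sat v phi.
  have dR : definable (size l).+2 R.
    apply: definable_ex_list => phi /hs'[/hs[p1 p2] _].
    by apply: definable_sat => //; move: p2; rewrite /= !size_map.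
  have Rext v w : v =1 w -> R v -> R w.
    by move=> e [phi h1 h2]; exists phi => //; apply/(sat_any_ext phi e).
  have [psi [psi1 psi2 psi3]] := dR.
  have [w hw] := below_set q p.1.
  (* The finite disjunction [psi] is a single formula, so one use of collection suffices. *)
  have [|c hc] := M_Delta0P psi1 (v := nth d (unzip1 l)) (w := w).
    move=> y _; apply: NNPP => hy; apply: hn; exists y => phi hphi [x hx].
    apply: hy; exists x; apply/psi3; exists phi => //.
    by apply: (proj1 (sat_any_ext phi _)) hx => -[|[]].
  (* [v 0] is the collecting set, so [p.1], and after transfer [p.2], sits at [i.+1]; bounding [y]
     by it keeps [Q] bounded. *)
  pose Q v := forall y, below q y (v i.+1) ->
    exists2 t, inn t (scons y v 1) & R (scons t (scons y v) \o rskip2).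
  have dQ : definable (size l).+1 Q.
    apply: (@definable_allbelow q _ i.+1 (fun v =>
      exists2 t, inn t (v 1) & R (scons t v \o rskip2))) => //.
    apply: (@definable_exin _ 1 (fun v => R (v \o rskip2))) => //.
    by apply: definable_rename dR; exact: rskip2_lt.
  have [|c' c'B hc'] := good_definable gl dQ.
    exists c => y; rewrite /= e1 => /hw/hc[t tc /psi3 ht]; exists t => //.
    by apply: Rext ht => -[|[]].
  have [|t tc' [phi phis' ht]] := hc' b; first by rewrite /= e2.
  have [_] := proj1 (hs' phi) phis'; apply; exists t; first exact: tB tc'.
  by rewrite (sat_any_ext _ (rskip2E _ _ _ _)) in ht.
exists y; split=> // phi h1 h2 h3.
have := hy phi h1; rewrite /= !map_odflt_Some => H; apply: H h3.
by move: h2; rewrite /= !size_map.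
Qed.

Definition fTrans (i : nat) : form := fAllIn i (fAllIn 0 (fIn 0 i.+2)).

Lemma Delta0P_fTrans i : Delta0P (fTrans i).
Proof. by do 3 constructor. Qed.

Lemma sat_fTrans v i : sat v (fTrans i) <-> transitive_set (v i).
Proof. by []. Qed.

Lemma transitive_bound T (s : seq T) (Q : T -> M -> Prop) :
  (forall t, List.In t s -> exists x, Q t x) ->
  exists2 w, transitive_set w & forall t, List.In t s -> exists2 x, inn x w & Q t x.
Proof.
move=> /(finite_bound d)[w [_ hw]]; have [w' tw' ww'] := Mac_tc M_Mac w.
by exists w' => // t /hw[x /ww' xw hx]; exists x.
Qed.

(** Finitely many true sentences [exists x, phi(x)] have witnesses in one transitive set.
    Saturation, with [None] making the variable of the type the bound, gives one set for all of
    them. *)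
Lemma good_nil : exists B, good [::] B.
Proof.
have [|||y /sat_fTrans ty hy] :=
  @saturation M M_recsat d [::] (fTrans 0) [::] [::] None => //.
  move=> s hs.
  have [s' hs'] := list_sub (fun phi => exists x, sat (nth d [:: x]) phi) s.
  have [w tw hw] := transitive_bound (fun phi h => proj2 (proj1 (hs' phi) h)).
  by exists w => [|phi hphi hx]; [apply/sat_fTrans|apply: hw; apply/hs'].
by exists y; split.
Qed.

(** Skips indices 1 and 2, which hold a dummy and the set bounding the witnesses. *)
Definition rskip12 (i : nat) : nat := if i is j.+1 then j.+3 else i.

(* If [B] cannot be shrunk so as not to include [c], then finitely many
   instances of the type already force this; a transitive set [a] containing
   their witnesses has an image that includes [c]. *)
Lemma shrink l B c : good l B ->
  (exists B', [/\ good l B', subset B' B & ~ subset c B']) \/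
  (exists a b, good ((a, b) :: l) B /\ subset c b).
Proof.
move=> gl; have [tB _] := gl.
pose theta := fAnd (fAnd (fIn 0 1) (fTrans 0)) (fNeg (fSub 2 0)).
have thetaP y : sat (nth d [:: y; B; c]) theta <->
    [/\ inn y B, transitive_set y & ~ subset c y].
  by split=> [[[h1 h2] h3]|[h1 h2 h3]].
(* [None] makes the variable of the type the new bound. *)
have := @saturation M M_recsat d [:: B; c] theta
  (map some (unzip1 l)) (map some (unzip2 l)) None.
rewrite !size_map => /(_ erefl isT) sat.
case: (classic (forall s : seq form, (forall phi, List.In phi s ->
    Delta0P phi /\ fv_below (size l).+1 phi) ->
  exists2 y, Defs.sat (nth d [:: y; B; c]) theta &
    forall phi, List.In phi s ->
    (exists x, Defs.sat (nth d (x :: unzip1 l)) phi) ->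
    exists2 x, inn x y & Defs.sat (nth d (x :: unzip2 l)) phi)) => [fin|nfin].
  left; case: sat => [s hs|y /thetaP[yB ty ny] hy].
    have [y y1 y2] := fin s hs; exists y => // phi hphi.
    by rewrite !map_odflt_Some; exact: y2.
  exists y; split=> //; last exact: tB.
  split=> // phi h1 h2; have := hy phi h1 h2.
  by rewrite !map_odflt_Some.
right; have [s ns] := not_all_ex_not _ _ nfin.
have [hs {}ns] := imply_to_and _ _ ns.
have [s' hs'] := list_sub
  (fun phi => exists x, Defs.sat (nth d (x :: unzip1 l)) phi) s.
have [a ta ha] := transitive_bound (fun phi h => proj2 (proj1 (hs' phi) h)).
have [b gb] := forth a gl.
(* [v 1] is [a], and after transfer [b]; [v 0] is a dummy. *)
pose R v := Defs.sat v (fTrans 1) /\ forall phi, List.In phi s' ->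
  exists2 x, inn x (v 1) & Defs.sat (scons x v \o rskip12) phi.
have dR : definable (size l).+2 R.
  apply: definable_and; first by apply: definable_sat => //; exact: Delta0P_fTrans.
  apply: definable_all_list => phi /hs'[/hs[p1 p2] _].
  apply: (@definable_exin _ 1 (fun v => Defs.sat (v \o rskip12) phi)) => //.
  apply: (@definable_rename (size l).+1 _ rskip12 (fun v => Defs.sat v phi)).
    by case.
  exact: definable_sat.
have skipE x y z (u : seq M) :
    scons x (nth d (y :: z :: u)) \o rskip12 =1 nth d (x :: u) by case.
have [|z _ [/sat_fTrans /= tb hb]] := good_definable gb dR.
  exists d; split; first exact/sat_fTrans.
  move=> phi /ha[x xa hx]; exists x => //.
  by rewrite (sat_any_ext _ (skipE _ _ _ _)).
(* If [c] were not included in [b], then [b] would realise the finite part [s] of the type, against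
   the choice of [s]. *)
exists a, b; split=> //; apply: NNPP => nb; apply: ns; exists b.
  by apply/thetaP; split=> //; apply: (good_range gb (p := (a, b))); left.
move=> phi hphi hx; have [|x xb h] := hb phi; first exact/hs'.
by exists x => //; rewrite (sat_any_ext _ (skipE _ _ _ _)) in h.
Qed.

(** [forth] puts [x] into the domain and [shrink] tries to keep it from being included in the bound.
    [back] puts it into the range whenever it is a member or a subset of a listed value, which
    covers the other outcome of [shrink]. *)
Lemma step l B x : good l B -> exists l' B',
  [/\ good l' B', forall p, List.In p l -> List.In p l', subset B' B,
      exists y, List.In (x, y) l' &
      (exists y, List.In (y, x) l') \/
      ((exists2 z, inn z x & ~ inn z B') /\
       forall q p, List.In p l -> ~ below q x p.2)].
Proof.
move=> /(forth x)[y g1].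
have [l2 [B2 [g2 ll2 BB2 h2]]] : exists l2 B2,
  [/\ good l2 B2, forall p, List.In p ((x, y) :: l) -> List.In p l2, subset B2 B
    & (exists q p, List.In p l2 /\ below q x p.2) \/ exists2 z, inn z x & ~ inn z B2].
  have [[B' [g' BB' nx]]|[a [b [g' xb]]]] := shrink x g1.
  - exists ((x, y) :: l), B'; split=> //; right.
    apply: NNPP => h; apply: nx => z zx; apply: NNPP => zB'.
    by apply: h; exists z.
  - exists ((a, b) :: (x, y) :: l), B; split=> //; first by right.
    by left; exists false, (a, b); split=> //; left.
have xl2 : List.In (x, y) l2 by apply: ll2; left.
have {}ll2 p : List.In p l -> List.In p l2 by move=> h; apply: ll2; right.
case: (classic (exists q p, List.In p l2 /\ below q x p.2)) => [[q [p [pl2 hq]]]|nb].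
- have [a g3] := back g2 pl2 hq.
  exists ((a, x) :: l2), B2; split=> //.
  + by move=> p' /ll2; right.
  + by exists y; right.
  + by left; exists a; left.
- exists l2, B2; split=> //; first by exists y.
  (* By [nb] only the second alternative of [h2] remains. *)
  right; split; first by case: h2.
  by move=> q p pl h; apply: nb; exists q, p; split=> //; exact: ll2.
Qed.

End BackAndForth.

(** * Isomorphism invariance *)

Section Isomorphism.
Variables (M N : structure) (h : M -> N).
Hypothesis h_inj : injective h.
Hypothesis h_surj : forall y, exists x, h x = y.
Hypothesis h_inn : forall x y, inn x y <-> inn (h x) (h y).
Implicit Types (x y z a b p r : M).

(** Rewritten from right to left, this makes quantifiers over [N] range over images of elements of
    [M]. *)
Lemma iso_forall (P : N -> Prop) : (forall x, P (h x)) <-> (forall y : N, P y).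
Proof.
by split=> H y; last exact: H; have [x <-] := h_surj y.
Qed.

Lemma iso_exists (P : N -> Prop) : (exists x, P (h x)) <-> (exists y : N, P y).
Proof.
split=> [[x hx]|[y]]; first by exists (h x).
by have [x <-] := h_surj y; exists x.
Qed.

Lemma iso_eq x y : h x = h y <-> x = y.
Proof. by split=> [/h_inj|->]. Qed.

Lemma iso_sat phi (v : nat -> M) (w : nat -> N) :
  (forall i, h (v i) = w i) -> sat v phi <-> sat w phi.
Proof.
elim: phi v w => [i j|i j|f IH|f IHf g IHg|f IHf g IHg|f IHf g IHg|f IH|f IH]
  v w e /=.
- by rewrite -!e iso_eq.
- by rewrite -!e -h_inn.
- by rewrite (IH _ _ e).
- by rewrite (IHf _ _ e) (IHg _ _ e).
- by rewrite (IHf _ _ e) (IHg _ _ e).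
- by rewrite (IHf _ _ e) (IHg _ _ e).
- have H x : sat (scons x v) f <-> sat (scons (h x) w) f by apply: IH => -[].
  by rewrite -iso_forall; split=> K x; apply/H.
- have H x : sat (scons x v) f <-> sat (scons (h x) w) f by apply: IH => -[].
  by rewrite -iso_exists; split=> -[x /H]; exists x.
Qed.

Lemma iso_subset x y : subset (h x) (h y) <-> subset x y.
Proof.
rewrite /subset -iso_forall; split=> H z; first by rewrite h_inn => /H/h_inn.
by rewrite -!h_inn; exact: H.
Qed.

Lemma iso_transitive x : transitive_set (h x) <-> transitive_set x.
Proof.
rewrite /transitive_set -iso_forall; split=> H z.
- by rewrite h_inn => /H/iso_subset.
- by rewrite -h_inn => /H/iso_subset.
Qed.

Lemma iso_upair p a b : is_upair (h p) (h a) (h b) <-> is_upair p a b.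
Proof.
rewrite /is_upair -iso_forall; split=> H z.
- by rewrite h_inn H !iso_eq.
- by rewrite -h_inn H !iso_eq.
Qed.

Lemma iso_opair p a b : is_opair (h p) (h a) (h b) <-> is_opair p a b.
Proof.
split=> [[s [t]]|[s [t [h1 h2 h3]]]].
- have [s' <-] := h_surj s; have [t' <-] := h_surj t.
  by case=> /iso_upair h1 /iso_upair h2 /iso_upair h3; exists s', t'.
- by exists (h s), (h t); split; apply/iso_upair.
Qed.

Lemma iso_well_orders (R : M -> M -> Prop) (S : N -> N -> Prop) x :
  (forall a b, R a b <-> S (h a) (h b)) ->
  well_orders R x -> well_orders S (h x).
Proof.
move=> RS [h1 h2 h3 h4]; split.
- by rewrite -iso_forall => a; rewrite -h_inn -RS; exact: h1.
- rewrite -iso_forall => a; rewrite -iso_forall => b; rewrite -iso_forall => c.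
  by rewrite -!h_inn -!RS; exact: h2.
- rewrite -iso_forall => a; rewrite -iso_forall => b; rewrite -!h_inn.
  move=> ax bx; case: (h3 a b ax bx) => [/RS|->|/RS].
  + exact: Or31.
  + exact: Or32.
  + exact: Or33.
- rewrite -iso_forall => u /iso_subset ux [b']; have [b <-] := h_surj b'.
  rewrite -h_inn => bu; have [|a au ha] := h4 u ux; first by exists b.
  exists (h a); first exact/h_inn.
  rewrite -iso_forall => c; rewrite -h_inn -RS iso_eq; exact: ha.
Qed.

Lemma iso_Separation Gamma : Separation M Gamma -> Separation N Gamma.
Proof.
move=> H phi hphi w a'; have [a <-] := h_surj a'.
(* The parameters are pulled back along [h] by choice. *)
pose v i := proj1_sig (constructive_indefinite_description _ (h_surj (w i))).
have e i : h (v i) = w i by rewrite /v; case: constructive_indefinite_description.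
have [b hb] := H phi hphi v a; exists (h b); rewrite -iso_forall => x.
rewrite -!h_inn hb (@iso_sat _ _ (scons (h x) w)) //; by case.
Qed.

Lemma iso_Collection Gamma : Collection M Gamma -> Collection N Gamma.
Proof.
move=> H phi hphi w a'; have [a <-] := h_surj a'.
pose v i := proj1_sig (constructive_indefinite_description _ (h_surj (w i))).
have e i : h (v i) = w i by rewrite /v; case: constructive_indefinite_description.
have satE y x : sat (scons y (scons x v)) phi <->
    sat (scons (h y) (scons (h x) w)) phi by apply: iso_sat => -[|[]].
move=> K; have [|c hc] := H phi hphi v a.
  move=> x /h_inn/K[y']; have [y <-] := h_surj y'.
  by move=> /satE; exists y.
exists (h c); rewrite -iso_forall => x; rewrite -h_inn => /hc[y yc /satE].
by exists (h y) => //; apply/h_inn.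
Qed.

Lemma iso_Mac : Mac M -> Mac N.
Proof.
move=> [ext pair emp uni inf pow tc sep fnd wo]; split.
- rewrite /Extensionality -iso_forall => x; rewrite -iso_forall => y.
  rewrite -iso_forall => H; congr h; apply: ext => z.
  by rewrite !h_inn.
- rewrite /Pairing -iso_forall => x; rewrite -iso_forall => y.
  by have [z hz] := pair x y; exists (h z); apply/iso_upair.
- have [x hx] := emp; exists (h x); rewrite -iso_forall => y.
  by rewrite -h_inn; exact: hx.
- rewrite /Union -iso_forall => x; have [y hy] := uni x; exists (h y).
  rewrite -iso_forall => z; rewrite -h_inn hy; split=> [[u h1 h2]|[u']].
  + by exists (h u); apply/h_inn.
  + by have [u <-] := h_surj u'; move=> /h_inn h1 /h_inn h2; exists u.
- have [x [[y yx hy] hx]] := inf; exists (h x); split.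
    exists (h y); first exact/h_inn.
    by rewrite -iso_forall => z; rewrite -h_inn; exact: hy.
  rewrite -iso_forall => t; rewrite -h_inn => /hx[z zx hz].
  exists (h z); first exact/h_inn.
  by rewrite -iso_forall => w; rewrite -!h_inn iso_eq.
- rewrite /Powerset -iso_forall => x; have [y hy] := pow x; exists (h y).
  by rewrite -iso_forall => z; rewrite -h_inn hy iso_subset.
- rewrite /TransitiveContainment -iso_forall => x; have [y ty xy] := tc x.
  by exists (h y); [apply/iso_transitive|apply/iso_subset].
- exact: iso_Separation.
- rewrite /SetFoundation -iso_forall => x [y']; have [y <-] := h_surj y'.
  rewrite -h_inn => yx; have [|z zx hz] := fnd x; first by exists y.
  exists (h z); first exact/h_inn.
  by rewrite -iso_forall => w; rewrite -!h_inn; exact: hz.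
- rewrite /WellOrdering -iso_forall => x; have [r [r1 r2]] := wo x.
  exists (h r); split.
    rewrite -iso_forall => p; rewrite -h_inn => /r1[a [b [ax bx hp]]].
    by exists (h a), (h b); split; [apply/h_inn|apply/h_inn|apply/iso_opair].
  apply: iso_well_orders r2 => a b; split=> [[p h1 h2]|[p']].
  + by exists (h p); [apply/iso_opair|apply/h_inn].
  + by have [p <-] := h_surj p'; move=> /iso_opair h1 /h_inn h2; exists p.
Qed.

Lemma iso_MOST : MOST M -> MOST N.
Proof.
case=> mac sep col; split.
- exact: iso_Mac.
- exact: iso_Separation.
- exact: iso_Collection.
Qed.

End Isomorphism.

(** * The union of a chain of finite partial embeddings *)

Theorem theorem5p6 (M : structure)
    (M_countable : countable_structure M)
    (M_recsat : recursively_saturated M)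
    (M_MOST : MOST M)
    (M_Delta0P : Collection M Delta0P) :
  exists h : M -> M, embedding h /\ H_cut (range h).
Proof.
have [M_Mac _ _] := M_MOST.
have [d _] := Mac_empty M_Mac.
have [f f_inj] := M_countable.
pose state := {s : seq (M * M) * M | good d s.1 s.2}.
pose lst (s : state) := (proj1_sig s).1.
pose bnd (s : state) := (proj1_sig s).2.
have lst_good s : good d (lst s) (bnd s) by case: s.
have next (s : state) n : {s' : state |
    [/\ forall p, List.In p (lst s) -> List.In p (lst s'),
        subset (bnd s') (bnd s)
      & forall x, f x = n ->
        (exists y, List.In (x, y) (lst s')) /\
        ((exists y, List.In (y, x) (lst s')) \/
         ((exists2 z, inn z x & ~ inn z (bnd s')) /\
          forall q p, List.In p (lst s) -> ~ below q x p.2))]}.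
  apply: constructive_indefinite_description.
  (* A number outside the image of [f] leaves the state unchanged. *)
  case: (classic (exists x, f x = n)) => [[x xn]|nx]; last first.
    by exists s; split=> // x e; case: nx; exists x.
  have [l' [B' [g' h1 h2 h3 h4]]] := step M_recsat M_Mac M_Delta0P x (lst_good s).
  exists (exist _ (l', B') g'); split=> // x'.
  by rewrite -xn => /f_inj ->.
have [B0 g0] := good_nil M_recsat d M_Mac.
(* Stage [k] treats the element numbered [cfst k], so each element is treated infinitely often. *)
pose seqs := fix seqs n : state :=
  if n is k.+1 then proj1_sig (next (seqs k) (cfst k))
  else exist (fun s => good d s.1 s.2) ([::], B0) g0.
have seqsS n := proj2_sig (next (seqs n) (cfst n)).
have lst_mono m n p : m <= n -> List.In p (lst (seqs m)) -> List.In p (lst (seqs n)).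
  move=> /subnK <-; elim: (n - m) => // k IH /IH h.
  by rewrite addSn; have [h1 _ _] := seqsS (k + m); exact: h1.
have bnd_mono m n : m <= n -> subset (bnd (seqs n)) (bnd (seqs m)).
  move=> /subnK <-; elim: (n - m) => // k IH z hz; apply: IH.
  by move: hz; rewrite addSn; have [_ h2 _] := seqsS (k + m); exact: h2.
pose graph x y := exists n, List.In (x, y) (lst (seqs n)).
have graph_pairs x y x' y' : graph x y -> graph x' y' ->
    (x = x' <-> y = y') /\ (inn x x' <-> inn y y').
  move=> [n hn] [m hm]; have [s [hs hs']] : exists s,
      List.In (x, y) (lst s) /\ List.In (x', y') (lst s).
    exists (seqs (n + m)).
    by split; [apply: lst_mono hn|apply: lst_mono hm]; lia.
  exact: good_pairs (lst_good s) hs hs'.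
have graph_bnd x y n : graph x y -> inn y (bnd (seqs n)).
  move=> [m hm]; apply: (bnd_mono n (n + m)); first by lia.
  apply: (good_range (lst_good (seqs (n + m))) (p := (x, y))).
  by apply: lst_mono hm; lia.
(* Treatment after any given stage [m] is wanted because [x] is compared only with pairs already
   listed; stage [cpair (f x) m] provides it. *)
have late x m : exists n,
    [/\ m <= n, exists y, List.In (x, y) (lst (seqs n.+1)) &
        (exists y, graph y x) \/
        ((exists2 z, inn z x & ~ inn z (bnd (seqs n.+1))) /\
         forall q p, List.In p (lst (seqs n)) -> ~ below q x p.2)].
  exists (cpair (f x) m); have [_ _ /(_ x)] := seqsS (cpair (f x) m).
  move=> /(_ (esym (cfst_cpair _ _)))[h1 h2]; split=> //; first exact: leq_cpair_r.
  by case: h2 => [[y hy]|h2]; [left; exists y, (cpair (f x) m).+1|right].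
have total x : exists y, graph x y.
  by have [n [_ [y hy] _]] := late x 0; exists y, n.+1.
pose h x := proj1_sig (constructive_indefinite_description _ (total x)).
have hP x : graph x (h x).
  by rewrite /h; case: constructive_indefinite_description.
have graph_range x y : graph x y -> range h y.
  by move=> g; exists x; have [[e _] _] := graph_pairs _ _ _ _ (hP x) g; exact: e.
have h_emb : embedding h.
  by split=> x y; have [h1 h2] := graph_pairs _ _ _ _ (hP x) (hP y); [case: h1|].
have range_below q x y : range h y -> below q x y -> range h x.
  (* Once [(a, h a)] is listed, a later treatment of [x] must accept it, as [x] is below [h a]. *)
  move=> [a <-] hx; have [m hm] := hP a; have [n [mn _ hn]] := late x m.
  case: hn => [[b /graph_range]//|[_ hn]].
  by case: (hn q (a, h a)) => //; apply: lst_mono hm.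
exists h; split=> //; split.
- split=> [x y|x y]; first by move=> hy hx; apply: (range_below true) hx.
  by move=> hy hx; apply: (range_below false) hx.
- split.
  + by move=> x y hy hx; apply: (range_below true) hx.
  (* The initial bound contains the whole range, so it would be a member of itself if it lay in the
     range. *)
  + exists (bnd (seqs 0)) => -[x hx]; apply: (inn_irrefl M_Mac (x := bnd (seqs 0))).
    by rewrite -{1}hx; apply: graph_bnd (hP x).
  (* If [c] were not accepted, some member of [c] would lie outside a bound; but members of [c] are
     in the range, hence in every bound. *)
  + move=> c hc; have [n [_ _ []]] := late c 0; first by case=> y /graph_range.
    move=> [[z zc nz] _]; case: nz; have [[z' [x hx]] _ /= <-] := hc z zc.
    by rewrite -hx; exact: (graph_bnd x _ n.+1 (hP x)).
- have [inj hinn] := h_emb.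
  pose hI x : substructure (range h) := exist _ (h x) (ex_intro _ x erefl).
  apply: (iso_MOST (h := hI)) => //.
  + by move=> x y [/inj].
  (* Taking [x] from the membership proof and eliminating [e] makes the two elements of the
     substructure identical, proof component included. *)
  + by case=> y [x e]; exists x; case: y / e.
Qed.
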